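(* Let $\mathbb{K}$ be a field with $\operatorname{char}\mathbb{K}\neq 2$, let $n\ge 3$, and let $Y$ be an $n\times n$ generic symmetric matrix over $\mathbb{K}$. Then $\operatorname{v}(P_2(Y))=3$.
   Context: An $n\times n$ generic symmetric matrix over $\mathbb{K}$ is the symmetric matrix $Y$ whose $(i,j)$ and $(j,i)$ entries, for $1\le i\le j\le n$, both equal $y_{ij}$, where $\{y_{ij}\mid 1\le i\le j\le n\}$ are distinct algebraically independent indeterminates (write also $y_{ji}=y_{ij}$). We work in the standard graded polynomial ring $\mathbb{K}[Y]=\mathbb{K}[y_{ij}\mid 1\le i\le j\le n]$. $P_2(Y)\subseteq\mathbb{K}[Y]$ denotes the $2\times 2$ permanental ideal of $Y$: the ideal generated by all $2\times2$ subpermanents $y_{ik}y_{jl}+y_{il}y_{jk}$ with $1\le i<j\le n$, $1\le k<l\le n$. For a graded ideal $I$ of a standard graded polynomial ring $R=\bigoplus_{d\ge0}R_d$ over a field, the $\operatorname{v}$-number of $I$ is $$\operatorname{v}(I)=\min\{d\mid \text{there exist } f\in R_d \text{ and } \mathfrak{p}\in\operatorname{Ass}(I)\text{ such that } (I:f)=\mathfrak{p}\},$$ where $\operatorname{Ass}(I)$ is the set of associated primes of $R/I$ and $(I:f)=\{g\in R\mid gf\in I\}$. *)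

(* Defs.v *)
From HB Require Import structures.
From mathcomp Require Import all_boot all_order all_algebra.
From mathcomp Require Import mpoly.

Set Implicit Arguments.
Unset Strict Implicit.
Unset Printing Implicit Defensive.

Import GRing.Theory.
Local Open Scope ring_scope.

(* Subsets of a ring are Prop-valued predicates, compared extensionally,
   because membership in an ideal need not be decidable a priori. *)
Section Ideals.
Variable R : comNzRingType.
Implicit Types (I p G : R -> Prop) (f g : R).

Definition same_set I p := forall g, I g <-> p g.

Definition is_ideal I :=
  [/\ I 0, forall a b, I a -> I b -> I (a + b) & forall c a, I a -> I (c * a)].

Definition ideal_gen G : R -> Prop := fun f =>
  exists (m : nat) (c g : 'I_m -> R),
    (forall k, G (g k)) /\ f = \sum_(k < m) c k * g k.

Definition prime_ideal p :=
  [/\ is_ideal p, ~ p 1 & forall a b, p (a * b) -> p a \/ p b].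

Definition colon I f : R -> Prop := fun g => I (g * f).

(* The annihilator of the class of h in R/I is (I : h). *)
Definition associated_prime I p :=
  prime_ideal p /\ exists h, same_set (colon I h) p.

End Ideals.

Section VNumber.
Variables (K : fieldType) (N : nat).
Implicit Type I : {mpoly K[N]} -> Prop.

Definition v_degree I (d : nat) :=
  exists (f : {mpoly K[N]}) (p : {mpoly K[N]} -> Prop),
    [/\ f \is d.-homog, associated_prime I p & same_set (colon I f) p].

(* v(I) = d; since the minimum of an empty set does not exist, v(I) is
   represented by its graph, which includes the existence of the minimum. *)
Definition is_v_number I (d : nat) :=
  v_degree I d /\ forall e, v_degree I e -> (d <= e)%N.

End VNumber.

Section GenericSymmetric.
Variables (K : fieldType) (n : nat).

Definition sym_index := {ij : 'I_n * 'I_n | (ij.1 <= ij.2)%N}.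

Lemma sym_sort_subproof (i j : 'I_n) :
  let ij := if (i <= j)%N then (i, j) else (j, i) in (ij.1 <= ij.2)%N.
Proof. by case: leqP => //= /ltnW. Qed.

Definition sym_sort (i j : 'I_n) : sym_index :=
  exist _ (if (i <= j)%N then (i, j) else (j, i)) (sym_sort_subproof i j).

(* mpoly's variables are numbered, so y_ij is the variable whose number is the
   rank of the pair (min i j, max i j) in the enumeration of sym_index. *)
Definition sym_poly := {mpoly K[#|{: sym_index}|]}.

Definition generic_symmx : 'M[sym_poly]_n :=
  \matrix_(i, j) 'X_(enum_rank (sym_sort i j)).

End GenericSymmetric.

Section PermanentalIdeal.
Variables (R : comNzRingType) (m n : nat) (A : 'M[R]_(m, n)).

Definition subpermanent2 (i j : 'I_m) (k l : 'I_n) : R :=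
  A i k * A j l + A i l * A j k.

Definition permanental_ideal2 : R -> Prop :=
  ideal_gen (fun g => exists (i j : 'I_m) (k l : 'I_n),
    [/\ (i < j)%N, (k < l)%N & g = subpermanent2 i j k l]).

End PermanentalIdeal.

(* Main.v *)
(* Dividing by 2, one gets y_ij y_kl (four distinct indices) and y_jk y_ij^2 in
   the permanental ideal I.

   Upper bound: every variable multiplies f = y_12 y_13 y_23 into I, while f is
   not in I because a signed sum of coefficients of multidegree (2,2,2) vanishes
   on I but not at f.  Hence (I : f) is the maximal graded ideal.

   Lower bound: a prime containing I contains every y_kl except possibly those
   with k, l in one pair {i, j}.  A quadric f such that y_kl f is in I for all
   these y_kl lies in I: signed sums of cubic coefficients that vanish on I give
   linear relations among the coefficients of f, and these relations define the
   degree 2 part of I.  When deg f < 2 and (I : f) is prime, either some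
   variable y is not in (I : f), and then (I : f) = (I : f y), or f is killed
   modulo I by all variables, which forces f = 0. *)

Require Import Defs.
From mathcomp Require Import all_boot all_order all_algebra.
From mathcomp Require Import mpoly ring zify.
From Stdlib Require Import Classical_Prop.

Set Implicit Arguments.
Unset Strict Implicit.
Unset Printing Implicit Defensive.

Import GRing.Theory.
Local Open Scope ring_scope.

(** * Closure properties of generated ideals *)

Section IdealClosure.
Variable R : comNzRingType.
Implicit Types (I : R -> Prop) (a b c g : R).

Lemma ideal_gen_ideal (G : R -> Prop) : is_ideal (ideal_gen G).
Proof.
split.
- exists 0, (fun _ => 0), (fun _ => 0); split; first by case.
  by rewrite big_ord0.
- move=> a b [m1 [c1 [g1 [G1 ->]]]] [m2 [c2 [g2 [G2 ->]]]].
  exists (m1 + m2)%N.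
  exists (fun k => match split k with inl i => c1 i | inr i => c2 i end).
  exists (fun k => match split k with inl i => g1 i | inr i => g2 i end).
  split=> [k|]; first by case: (split k).
  rewrite big_split_ord /=; congr (_ + _); apply: eq_bigr => i _.
    by rewrite (unsplitK (inl i)).
  by rewrite (unsplitK (inr i)).
- move=> c a [m [d [g [Gg ->]]]]; exists m, (fun k => c * d k), g.
  by split=> //; rewrite mulr_sumr; apply: eq_bigr => i _; rewrite mulrA.
Qed.

Lemma ideal_gen_gen (G : R -> Prop) g : G g -> ideal_gen G g.
Proof.
move=> Gg; exists 1%N, (fun _ => 1), (fun _ => g); split=> //.
by rewrite big_ord1 mul1r.
Qed.

Variables (I : R -> Prop) (idI : is_ideal I).

Lemma ideal_mull c a : I a -> I (c * a).
Proof. by case: idI => _ _; apply. Qed.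

Lemma ideal_mulr c a : I a -> I (a * c).
Proof. by rewrite mulrC; apply: ideal_mull. Qed.

Lemma ideal_add a b : I a -> I b -> I (a + b).
Proof. by case: idI => _ + _; apply. Qed.

Lemma ideal_sub a b : I a -> I b -> I (a - b).
Proof.
by move=> Ia Ib; apply: ideal_add => //; rewrite -mulN1r; apply: ideal_mull.
Qed.

Lemma ideal_sum (T : Type) (r : seq T) (P : pred T) (F : T -> R) :
  (forall i, P i -> I (F i)) -> I (\sum_(i <- r | P i) F i).
Proof.
by move=> IF; apply: (big_ind I) => //; [case: idI | apply: ideal_add].
Qed.

End IdealClosure.

(** * Monomials as lists of variables *)

Section Multinomials.
Variable N : nat.
Implicit Types s t : seq 'I_N.

(** Lists turn equality of monomials into the computable [perm_eq] and division by a variable into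
    [rem], which suits the finite check on weights. *)
Definition mnm_of_seq s : 'X_{1..N} := (\sum_(x <- s) U_(x))%MM.

Lemma mnm_of_seqE s i : mnm_of_seq s i = count_mem i s.
Proof.
rewrite /mnm_of_seq mnm_sumE; elim: s => [|x s IHs]; first by rewrite big_nil.
by rewrite big_cons IHs mnm1E.
Qed.

Lemma mnm_of_seq_eq s t : (mnm_of_seq s == mnm_of_seq t) = perm_eq s t.
Proof.
apply/eqP/idP => [eq_st|/permP eq_st].
  by apply/allP=> x _ /=; rewrite -!mnm_of_seqE eq_st.
by apply/mnmP=> i; rewrite !mnm_of_seqE eq_st.
Qed.

Lemma mdeg_mnm_of_seq s : mdeg (mnm_of_seq s) = size s.
Proof.
rewrite /mnm_of_seq mdeg_sum; elim: s => [|x s IHs]; first by rewrite big_nil.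
by rewrite big_cons IHs mdeg1.
Qed.

Lemma mnm_of_seq_cons x s : mnm_of_seq (x :: s) = (U_(x) + mnm_of_seq s)%MM.
Proof. by rewrite /mnm_of_seq big_cons. Qed.

Lemma mnm_of_seqP m : exists s, m = mnm_of_seq s.
Proof.
move: {2}(mdeg m) (erefl (mdeg m)) => d.
elim: d m => [|d IHd] m.
  move/eqP; rewrite mdeg_eq0 => /eqP->.
  by exists [::]; rewrite /mnm_of_seq big_nil.
move=> dm; have [i mi] : exists i, (0 < m i)%N.
  apply/existsP; apply: contraTT isT; rewrite negb_exists => /forallP m0.
  suff m_eq0 : m = 0%MM by rewrite m_eq0 mdeg0 in dm.
  by apply/mnmP=> j; apply/eqP; rewrite mnm0E -leqn0 leqNgt.
have leU : (U_(i) <= m)%MM by rewrite lep1mP -lt0n.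
have [|s ms] := IHd (m - U_(i))%MM.
  by move: dm; rewrite -{1}(submK leU) mdegD mdeg1 addn1 => -[].
by exists (i :: s); rewrite mnm_of_seq_cons -ms addmC submK.
Qed.

Lemma mdeg_mnm_of_seqP d m :
  mdeg m = d -> exists2 s, size s = d & m = mnm_of_seq s.
Proof.
by have [s ->] := mnm_of_seqP m; rewrite mdeg_mnm_of_seq => <-; exists s.
Qed.

Variable R : comNzRingType.
Implicit Types p : {mpoly R[N]}.

Lemma mcoeffMXU p i s :
  (p * 'X_i)@_(mnm_of_seq s) =
    if i \in s then p@_(mnm_of_seq (rem i s)) else 0.
Proof.
case: ifPn => [is_|nis].
  have /eqP-> : mnm_of_seq s == mnm_of_seq (i :: rem i s).
    by rewrite mnm_of_seq_eq perm_to_rem.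
  by rewrite mnm_of_seq_cons mcoeffMX.
(* Every monomial of [p * 'X_i] is divisible by ['X_i], whereas the monomial of [s] is not. *)
apply: memN_msupp_eq0; apply/negP => /msuppM_le; rewrite msuppX.
case/allpairsP => -[m1 m2] /= [_]; rewrite mem_seq1 => /eqP-> eq_s.
have := mnm_of_seqE s i; rewrite eq_s mnmDE mnm1E eqxx.
by rewrite (count_memPn nis) addnC.
Qed.

End Multinomials.

(** * Entries of the generic symmetric matrix *)

Section SymmetricVariables.
Variables (K : fieldType) (n : nat).

Definition symvar (i j : 'I_n) : 'I_#|{: sym_index n}| :=
  enum_rank (sym_sort i j).

Local Notation Y i j := ('X_(symvar i j) : sym_poly K n).
Local Notation P2 := (permanental_ideal2 (generic_symmx K n)).

Lemma symvarC i j : symvar i j = symvar j i.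
Proof.
congr enum_rank; apply: val_inj => /=.
by case: ltngtP => // /val_inj ->.
Qed.

Lemma symvar_eq i j k l :
  (symvar i j == symvar k l) = ((i == k) && (j == l)) || ((i == l) && (j == k)).
Proof.
apply/eqP/idP => [/enum_rank_inj/(congr1 val)/=|]; last first.
  by case/orP=> /andP[/eqP-> /eqP->] //; rewrite symvarC.
by do 2!case: ifP => _; case=> -> ->; rewrite !eqxx ?orbT.
Qed.

Lemma symvarP v : exists i j, v = symvar i j.
Proof.
have := valP (enum_val v); set ij := val (enum_val v) => le_ij.
exists ij.1, ij.2; apply: enum_val_inj; rewrite enum_rankK.
by apply: val_inj; rewrite /= le_ij -surjective_pairing.
Qed.

Lemma P2_ideal : is_ideal P2.
Proof. exact: ideal_gen_ideal. Qed.

(** The generators use increasing pairs of rows and columns; exchanging two rows or two columns only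
    permutes the terms of a permanent. *)
Lemma P2_swap i j k l : i != j -> k != l -> P2 (Y i k * Y j l + Y i l * Y j k).
Proof.
have P2_lt (a b c d : 'I_n) : (a < b)%N -> (c < d)%N ->
    P2 (Y a c * Y b d + Y a d * Y b c).
  move=> lt_ab lt_cd; apply: ideal_gen_gen; exists a, b, c, d; split=> //.
  by rewrite /subpermanent2 !mxE.
rewrite -!(inj_eq val_inj) !neq_ltn => /orP[] ij /orP[] kl.
- exact: P2_lt.
- by rewrite addrC; apply: P2_lt.
- rewrite [X in P2 X](_ : _ = Y j k * Y i l + Y j l * Y i k).
    exact: P2_lt.
  by ring.
- rewrite [X in P2 X](_ : _ = Y j l * Y i k + Y j k * Y i l).
    exact: P2_lt.
  by ring.
Qed.

End SymmetricVariables.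

(* Index classes: 0, 1, 2 stand for three chosen distinct indices and 3 for all
   the others.  An entry class (a, b), a <= b, stands for a variable y_ij.  A
   weight is a list of cubic monomials with signs ([true] meaning -1), seen as a
   signed sum of coefficients.  That this sum vanishes on the ideal is a finite
   check on classes: exchanging two column indices must flip the sign. *)
Notation entry_class := (nat * nat)%type.
Notation weight := (seq (bool * seq entry_class)).

Definition entry_sort (a b : nat) : entry_class :=
  if (a <= b)%N then (a, b) else (b, a).

Definition chosen_class (c : entry_class) := (c.1 <= c.2)%N && (c.2 < 3)%N.

Definition weight_at (T : weight) (s : seq entry_class) : int :=
  foldr (fun (t : bool * seq entry_class) z =>
    (if perm_eq s t.2 then (-1) ^+ t.1 else 0) + z) 0 T.

Definition weight_swap (T : weight) (i j k l u v : nat) :=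
  weight_at T [:: entry_sort i k; entry_sort j l; entry_sort u v]
  + weight_at T [:: entry_sort i l; entry_sort j k; entry_sort u v].

(* Two distinct indices of equal class both have class 3. *)
Definition class_neq (a b : nat) := (a != b) || (a == 3).

Definition weight_ok (T : weight) :=
  all (fun t => all chosen_class t.2 && (size t.2 == 3)) T &&
  (let r := iota 0 4 in
   all (fun i => all (fun j => all (fun k => all (fun l =>
     class_neq i j && class_neq k l ==>
       all (fun u => all (fun v => weight_swap T i j k l u v == 0) r) r)
     r) r) r) r).

(* The name of a weight is the multidegree of its monomials in the indices. *)
Definition weight222 : weight :=
  [:: (false, [:: (0, 0); (1, 1); (2, 2)]);
      (true, [:: (0, 0); (1, 2); (1, 2)]);
      (true, [:: (1, 1); (0, 2); (0, 2)]);
      (true, [:: (2, 2); (0, 1); (0, 1)]);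
      (false, [:: (1, 2); (0, 2); (0, 1)])].

Definition weight411 : weight :=
  [:: (false, [:: (0, 0); (0, 0); (1, 2)]);
      (true, [:: (0, 0); (0, 2); (0, 1)])].

Definition weight330 : weight :=
  [:: (false, [:: (0, 1); (0, 1); (0, 1)]);
      (true, [:: (0, 0); (1, 1); (0, 1)])].

Definition weight420 : weight :=
  [:: (false, [:: (0, 0); (0, 0); (1, 1)]);
      (true, [:: (0, 0); (0, 1); (0, 1)])].

Definition weight600 : weight := [:: (false, [:: (0, 0); (0, 0); (0, 0)])].

Lemma weights_ok :
  all weight_ok [:: weight222; weight411; weight330; weight420; weight600].
Proof. by vm_compute. Qed.

(** * Linear functionals in cubic coefficients that vanish on the ideal *)

Section Functional.
Variables (K : fieldType) (n : nat) (p q r : 'I_n).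
Hypotheses (neq_pq : p != q) (neq_pr : p != r) (neq_qr : q != r).

Local Notation Y i j := ('X_(symvar i j) : sym_poly K n).
Local Notation P2 := (permanental_ideal2 (generic_symmx K n)).

Definition index_class (i : 'I_n) : nat :=
  if i == p then 0 else if i == q then 1 else if i == r then 2 else 3.

(** The default of [nth] is never reached from a chosen class, whose components are below 3. *)
Definition class_index (a : nat) : 'I_n := nth p [:: p; q; r] a.

Definition class_var (c : entry_class) :=
  symvar (class_index c.1) (class_index c.2).

Definition var_class (v : 'I_#|{: sym_index n}|) :=
  let ij := val (enum_val v) in
  entry_sort (index_class ij.1) (index_class ij.2).

Lemma var_class_symvar i j :
  var_class (symvar i j) = entry_sort (index_class i) (index_class j).
Proof.
rewrite /var_class enum_rankK /=; case: leqP => //= _; rewrite /entry_sort.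
by case: ltngtP => // ->.
Qed.

Lemma index_classK i :
  (index_class i < 3)%N -> class_index (index_class i) = i.
Proof. by rewrite /index_class; do !case: eqP => [->|_] //. Qed.

Lemma class_indexK a : (a < 3)%N -> index_class (class_index a) = a.
Proof.
case: a => [|[|[|]]] //= _; rewrite /index_class ?eqxx //.
  by rewrite eq_sym (negPf neq_pq).
by rewrite eq_sym (negPf neq_pr) eq_sym (negPf neq_qr).
Qed.

Lemma class_varK c : chosen_class c -> var_class (class_var c) = c.
Proof.
case: c => a b /andP[/= le_ab lt_b]; rewrite var_class_symvar !class_indexK //.
  by rewrite /entry_sort le_ab.
exact: leq_ltn_trans lt_b.
Qed.

Lemma var_classK v : chosen_class (var_class v) -> class_var (var_class v) = v.
Proof.
have [i [j ->]] := symvarP v; rewrite var_class_symvar /entry_sort.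
rewrite /chosen_class /class_var.
case: (leqP (index_class i)) => [le_ij|lt_ji] /andP[/= _ lt3].
  by rewrite /= !index_classK //; apply: leq_ltn_trans lt3.
by rewrite /= !index_classK 1?symvarC //; apply: ltn_trans lt3.
Qed.

(** A chosen class names exactly one variable: there [class_var] and [var_class] are mutually
    inverse, so multisets of variables can be compared by class. *)
Lemma perm_class_var s t : all chosen_class t ->
  perm_eq s (map class_var t) = perm_eq (map var_class s) t.
Proof.
move=> /allP t_ok; apply/idP/idP => [/(perm_map var_class)|eq_st].
  rewrite -map_comp map_id_in // => c /t_ok.
  exact: class_varK.
have := perm_map class_var eq_st; rewrite -map_comp map_id_in //.
move=> v vs /=; apply: var_classK; apply: t_ok.
by rewrite -(perm_mem eq_st) map_f.
Qed.

Definition functional (T : weight) (f : sym_poly K n) : K :=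
  \sum_(t <- T) (-1) ^+ t.1 * f@_(mnm_of_seq (map class_var t.2)).

Lemma functionalD T f g :
  functional T (f + g) = functional T f + functional T g.
Proof.
by rewrite -big_split; apply: eq_bigr => t _; rewrite mcoeffD mulrDr.
Qed.

Lemma functionalZ T c f : functional T (c *: f) = c * functional T f.
Proof. by rewrite mulr_sumr; apply: eq_bigr => t _; rewrite mcoeffZ mulrCA. Qed.

Lemma functional0 T : functional T 0 = 0.
Proof. by rewrite -[0](scale0r 0) functionalZ mul0r. Qed.

(** On a monomial the functional is an integer that depends only on classes, hence computable
    uniformly in [K] and [n]. *)
Lemma functionalX T s : all (fun t => all chosen_class t.2) T ->
  functional T 'X_[mnm_of_seq s] = (weight_at T (map var_class s))%:~R.
Proof.
rewrite /functional; elim: T => [|t T IHT] /=; first by rewrite big_nil.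
case/andP=> t_ok /IHT{IHT}; rewrite big_cons => ->; rewrite rmorphD /=.
congr (_ + _); rewrite mcoeffX mnm_of_seq_eq perm_class_var //.
by case: ifP => _; rewrite ?mulr0 ?mulr1 // rmorphXn rmorphN1.
Qed.

(** By linearity it suffices to treat a monomial times a permanent. *)
Lemma functional_P2 T f : weight_ok T -> P2 f -> functional T f = 0.
Proof.
case/andP=> /allP T_ok /allP swapT [m [c [g [gP ->]]]].
elim/big_ind: _ => [|f1 f2 f1_0 f2_0|a _]; first exact: functional0.
  by rewrite functionalD f1_0 f2_0 addr0.
have [i [j [k [l [lt_ij lt_kl ->]]]]] := gP a.
rewrite /subpermanent2 !mxE -!/(symvar _ _) (mpolyE (c a)) mulr_suml.
elim/big_ind: _ => [|f1 f2 f1_0 f2_0|e _]; first exact: functional0.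
  by rewrite functionalD f1_0 f2_0 addr0.
rewrite -scalerAl functionalZ; suff ->: functional T
  ('X_[e] * (Y i k * Y j l + Y i l * Y j k)) = 0 by rewrite mulr0.
have [s ->] := mnm_of_seqP e; rewrite mulrDr functionalD.
have XYY u v : 'X_[mnm_of_seq s] * ('X_u * 'X_v) =
    'X_[mnm_of_seq [:: u, v & s]] :> sym_poly K n.
  by rewrite !mnm_of_seq_cons !mpolyXD mulrC -mulrA.
have Tcl : all (fun t => all chosen_class t.2) T.
  by apply/allP => t /T_ok/andP[].
rewrite !XYY !functionalX // -rmorphD /= !var_class_symvar.
have lt4 x : index_class x \in iota 0 4.
  by rewrite mem_iota /index_class; do !case: ifP.
have neqC (x y : 'I_n) : (x < y)%N -> class_neq (index_class x) (index_class y).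
  move=> lt_xy; rewrite /class_neq -implyNb negbK; apply/implyP => /eqP eq_xy.
  apply: contraTT lt_xy => x3.
  have lt3 z : index_class z != 3 -> (index_class z < 3)%N.
    by rewrite /index_class; do !case: ifP.
  by rewrite -(index_classK (lt3 _ x3)) eq_xy index_classK ?ltnn //
    lt3 // -eq_xy.
(* A monomial factor of degree one gives cubics, settled by the finite check; any other degree
   misses all monomials of [T], which are cubic. *)
have [size_s|size_s] := eqVneq (size s) 1%N.
  case: s size_s {XYY} => [|v [|]] //= _; have [u1 [u2 ->]] := symvarP v.
  rewrite var_class_symvar.
  have swap_ijk := allP (allP (swapT _ (lt4 i)) _ (lt4 j)) _ (lt4 k).
  have /implyP := allP swap_ijk _ (lt4 l); rewrite !neqC // => /(_ isT) swap_uv.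
  have /eqP := allP (allP swap_uv _ (lt4 u1)) _ (lt4 u2).
  by rewrite /weight_swap => ->.
have weight0 z : size z != 3 -> weight_at T z = 0.
  move=> z3; elim: (T) T_ok => //= t T' IHT T'_ok.
  rewrite IHT => [|x xT]; last by rewrite T'_ok // inE xT orbT.
  case: ifP => // /perm_size sz; have /andP[_] := T'_ok t (mem_head _ _).
  by rewrite -sz (negPf z3).
by rewrite !weight0 ?addr0 //= size_map !eqSS.
Qed.

(** A functional vanishing at f y thus becomes a linear relation among coefficients of [f]: the
    monomials of [T] divisible by y contribute, with one y removed. *)
Lemma functionalMX T f c : all (fun t => all chosen_class t.2) T ->
  chosen_class c ->
  functional T (f * 'X_(class_var c)) =
  \sum_(t <- T) (-1) ^+ t.1 * (if c \in t.2 then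
     f@_(mnm_of_seq (map class_var (rem c t.2))) else 0).
Proof.
move=> /allP T_ok c_ok; rewrite /functional big_seq [RHS]big_seq.
apply: eq_bigr => t /T_ok t_ok; congr (_ * _); rewrite mcoeffMXU.
have inj : {in c :: t.2 &, injective class_var}.
  have/allP ct_ok : all chosen_class (c :: t.2) by rewrite /= c_ok.
  by apply: (can_in_inj (g := var_class)) => x /ct_ok; apply: class_varK.
have -> : (class_var c \in [seq class_var i | i <- t.2]) = (c \in t.2).
  apply/mapP/idP => [[d dt /inj->]|ct]; rewrite ?inE ?eqxx ?dt ?orbT //.
  by exists c.
case: ifP => // ct; suff -> : rem (class_var c) (map class_var t.2) =
  map class_var (rem c t.2) by [].
elim: (t.2) inj {ct t_ok} => //= d s IHs inj.
rewrite (inj_in_eq inj) ?inE ?eqxx ?orbT //; case: ifP => //= _.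
rewrite IHs // => x y xs ys; apply: inj; rewrite !inE in xs ys *.
  by case/orP: xs => ->; rewrite ?orbT.
by case/orP: ys => ->; rewrite ?orbT.
Qed.

End Functional.

Lemma exists_third n (i j : 'I_n) :
  (3 <= n)%N -> exists k, (k != i) && (k != j).
Proof.
move=> n_ge3; apply/existsP; rewrite -[[exists _, _]]negbK negb_exists.
apply/negP => /forallP ij_all; have: (n <= #|[set i; j]|)%N.
  rewrite -{1}(card_ord n); apply/subset_leq_card/subsetP => k _.
  by have := ij_all k; rewrite negb_and !negbK !inE.
by rewrite cards2; case: eqP => _; lia.
Qed.

(** * Monomials in the ideal and primes containing it *)

Section PermanentalIdealTheory.
Variables (K : fieldType) (n : nat).
Hypotheses (two_neq0 : 2%:R != 0 :> K) (n_ge3 : (3 <= n)%N).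
Implicit Types (f g : sym_poly K n) (i j k l p q r : 'I_n).

Local Notation Y i j := ('X_(symvar i j) : sym_poly K n).
Local Notation P2 := (permanental_ideal2 (generic_symmx K n)).
Local Notation idP2 := (P2_ideal K n).
Local Notation mon := mnm_of_seq.

(** Characteristic different from 2 enters here. *)
Lemma ideal_half (I : sym_poly K n -> Prop) f : is_ideal I -> I (f + f) -> I f.
Proof.
move=> idI If; have := ideal_mull idI (2%:R^-1)%:MP If.
by rewrite -mulr2n -scaler_nat mul_mpolyC scalerA mulVf // scale1r.
Qed.

Lemma P2_disjoint i j k l : uniq [:: i; j; k; l] -> P2 (Y i j * Y k l).
Proof.
rewrite /= !inE !negb_or => /and4P[/and3P[ij ik il] /andP[jk jl] kl _].
apply: ideal_half idP2 _.
(* With A = y_ij y_kl, B = y_ik y_jl, C = y_il y_jk, the sums A + B, A + C, B + C are permanents,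
   and (A + B) + (A + C) - (B + C) = 2 A. *)
have AB := P2_swap K il jk; have AC := P2_swap K ik jl.
have BC := P2_swap K ij kl.
rewrite (symvarC l k) (symvarC l j) in AB; rewrite (symvarC k j) in AC.
have := ideal_sub idP2 (ideal_add idP2 AB AC) BC.
by congr P2; ring.
Qed.

Lemma P2_adjacent i j k : uniq [:: i; j; k] -> P2 (Y j k * Y i j * Y i j).
Proof.
rewrite /= !inE !negb_or => /and3P[/andP[ij ik] jk _].
apply: ideal_half idP2 _; have ji : j != i by rewrite eq_sym.
(* The combination y_jk [Gij] + y_ij [Gj] - y_jj [Gi] equals 2 y_jk y_ij^2. *)
have Gij := P2_swap K ij ij; have Gj := P2_swap K ji jk.
have Gi := P2_swap K ij ik.
rewrite (symvarC j i) in Gij Gi.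
have := ideal_sub idP2 (ideal_add idP2 (ideal_mull idP2 (Y j k) Gij)
  (ideal_mull idP2 (Y i j) Gj)) (ideal_mull idP2 (Y j j) Gi).
by congr P2; ring.
Qed.

(** If an off-diagonal y_ij is outside [I], [adj] and [disj] put in [I] every off-diagonal variable
    with an index k outside {i, j}; then y_kk y_ij + y_kj y_ik forces y_kk into [I]. If all
    off-diagonal variables lie in [I], so do products of two distinct diagonal ones, hence at most
    one of these is outside [I]. *)
Lemma prime_P2_support (I : sym_poly K n -> Prop) :
  prime_ideal I -> (forall f, P2 f -> I f) ->
  exists i j, i != j /\
    forall k l, ~~ ((k \in [:: i; j]) && (l \in [:: i; j])) -> I (Y k l).
Proof.
move=> [idI _ prI] P2I.
have cross a b c d : a != b -> c != d -> I (Y a d * Y b c) -> I (Y a c * Y b d).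
  move=> ab cd Iad; have := ideal_sub idI (P2I _ (P2_swap K ab cd)) Iad.
  by rewrite addrK.
have adj a b c : uniq [:: a; b; c] -> I (Y a b) \/ I (Y b c).
  by move/P2_adjacent/P2I/prI => [/prI|]; tauto.
have disj a b c d : uniq [:: a; b; c; d] -> I (Y a b) \/ I (Y c d).
  by move/P2_disjoint/P2I/prI.
have offdiag_mul a b : a != b -> I (Y a b) -> I (Y a a) \/ I (Y b b).
  by move=> ab Iab; apply: prI; apply: (cross _ _ _ _ ab ab); apply: ideal_mulr.
case: (classic (exists i j, i != j /\ ~ I (Y i j))) => [[i [j [ij nIij]]]|off].
  have out k l : k != i -> k != j -> I (Y k l).
    move=> ki kj; have ik : i != k by rewrite eq_sym.
    have jk : j != k by rewrite eq_sym.
    have out_off l1 : l1 != k -> I (Y k l1).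
      move=> lk; have [->|li] := eqVneq l1 i.
        have /adj[] : uniq [:: j; i; k].
          by rewrite /= !inE negb_or eq_sym ij jk ik.
          by rewrite symvarC => /nIij.
        by rewrite symvarC.
      have [->|lj] := eqVneq l1 j.
        have /adj[//|] : uniq [:: i; j; k] by rewrite /= !inE negb_or ij jk ik.
        by rewrite symvarC.
      suff /disj[] : uniq [:: i; j; k; l1] by [].
      by rewrite /= !inE !negb_or ij ik jk ![_ == l1]eq_sym li lj lk.
    have [->|lk] := eqVneq l k; last exact: out_off.
    have /prI[//|//] : I (Y k k * Y i j).
    by apply: (cross _ _ _ _ ki kj); apply: ideal_mulr => //; apply: out_off.
  exists i, j; split=> // k l; rewrite !inE negb_and !negb_or.
  by case/orP => /andP[]; [|rewrite symvarC]; apply: out.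
have Ioff i j : i != j -> I (Y i j).
  by move=> ij; apply: NNPP => nI; apply: off; exists i, j.
case: (classic (exists i, ~ I (Y i i))) => [[i nIi]|diag].
  have [j /andP[ji _]] := exists_third i i n_ge3.
  exists i, j; split=> [|k l]; first by rewrite eq_sym.
  have [<-|kl _] := eqVneq k l; last exact: Ioff.
  rewrite !inE andbb negb_or eq_sym => /andP[ik _].
  by case: (offdiag_mul _ _ ik (Ioff _ _ ik)).
(* All variables lie in [I], so any pair serves; [n_ge3] unfolds to 2 < n and so provides an
   index. *)
have [j /andP[ji _]] := exists_third (Ordinal n_ge3) (Ordinal n_ge3) n_ge3.
exists j, (Ordinal n_ge3); split=> // k l _.
have [<-|] := eqVneq k l; last exact: Ioff.
by apply: NNPP => nI; apply: diag; exists k.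
Qed.

(** * Coefficient relations for a quadric killed by a variable *)

Lemma functional_kill p q r T c f : uniq [:: p; q; r] ->
  T \in [:: weight222; weight411; weight330; weight420; weight600] ->
  chosen_class c -> P2 (f * 'X_(class_var p q r c)) ->
  \sum_(t <- T) (-1) ^+ t.1 * (if c \in t.2 then
     f@_(mon (map (class_var p q r) (rem c t.2))) else 0) = 0.
Proof.
move=> + /(allP weights_ok) T_ok c_ok Pf.
rewrite /= !inE negb_or => /and3P[/andP[pq pr] qr _].
rewrite -functionalMX ?functional_P2 //.
by case/andP: T_ok => /allP T_ok _; apply/allP => t /T_ok/andP[].
Qed.

Lemma mon2C (u v : 'I_#|{: sym_index n}|) : mon [:: u; v] = mon [:: v; u].
Proof. by apply/eqP; rewrite mnm_of_seq_eq (perm_catC [:: u]). Qed.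

(* Each relation among degree 2 coefficients of f comes in two variants, with
   different variables killing f, because which variables outside the special
   pair {i, j} of [P2_quadric_of_killed] are available depends on the
   monomial. *)
Lemma coef_loops p r f : p != r -> P2 (f * Y r r) ->
  f@_(mon [:: symvar p p; symvar p p]) = 0.
Proof.
move=> pr Pf; have [q /andP[qp qr]] := exists_third p r n_ge3.
have u : uniq [:: p; r; q] by rewrite /= !inE negb_or pr ![_ == q]eq_sym qp qr.
(* With [r] in class 1, only the first monomial of [weight420] contains y_rr, so a single
   coefficient has to vanish. *)
have := functional_kill (T := weight420) (c := (1, 1)) u isT isT Pf.
by rewrite !big_cons big_nil /= mulr0 !addr0 mul1r.
Qed.

Lemma coef_loops_self p f : P2 (f * Y p p) ->
  f@_(mon [:: symvar p p; symvar p p]) = 0.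
Proof.
move=> Pf; have [q /andP[qp _]] := exists_third p p n_ge3.
have [r /andP[rp rq]] := exists_third p q n_ge3.
have u : uniq [:: p; q; r].
  by rewrite /= !inE negb_or ![p == _]eq_sym qp rp eq_sym rq.
have := functional_kill (T := weight600) (c := (0, 0)) u isT isT Pf.
by rewrite !big_cons big_nil /= !addr0 mul1r.
Qed.

Lemma coef_loop_edge_self p q f : p != q -> P2 (f * Y p q) ->
  f@_(mon [:: symvar p p; symvar p q]) = 0.
Proof.
move=> pq Pf; have [r /andP[rp rq]] := exists_third p q n_ge3.
have u : uniq [:: p; q; r] by rewrite /= !inE negb_or pq ![_ == r]eq_sym rp rq.
have := functional_kill (T := weight420) (c := (0, 1)) u isT isT Pf.
rewrite !big_cons big_nil /= mulr0 add0r addr0 mulN1r => /eqP.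
by rewrite oppr_eq0 => /eqP.
Qed.

Lemma coef_loop_edge p q r f : uniq [:: p; q; r] -> P2 (f * Y p r) ->
  f@_(mon [:: symvar p p; symvar p q]) = 0.
Proof.
move=> u Pf.
have := functional_kill (T := weight411) (c := (0, 2)) u isT isT Pf.
rewrite !big_cons big_nil /= mulr0 add0r addr0 mulN1r => /eqP.
by rewrite oppr_eq0 => /eqP.
Qed.

Lemma coef_two_loops p q r f : uniq [:: p; q; r] -> P2 (f * Y r r) ->
  f@_(mon [:: symvar p p; symvar q q]) = f@_(mon [:: symvar p q; symvar p q]).
Proof.
move=> u Pf.
have := functional_kill (T := weight222) (c := (2, 2)) u isT isT Pf.
rewrite !big_cons big_nil /= !mulr0 !addr0 !add0r mul1r mulN1r => /eqP.
by rewrite subr_eq0 => /eqP.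
Qed.

Lemma coef_two_loops_self p q f : p != q -> P2 (f * Y p q) ->
  f@_(mon [:: symvar p p; symvar q q]) = f@_(mon [:: symvar p q; symvar p q]).
Proof.
move=> pq Pf; have [r /andP[rp rq]] := exists_third p q n_ge3.
have u : uniq [:: p; q; r] by rewrite /= !inE negb_or pq ![_ == r]eq_sym rp rq.
have := functional_kill (T := weight330) (c := (0, 1)) u isT isT Pf.
rewrite !big_cons big_nil /= addr0 mul1r mulN1r => /eqP.
by rewrite subr_eq0 => /eqP.
Qed.

Lemma coef_path p q r f : uniq [:: p; q; r] -> P2 (f * Y p p) ->
  f@_(mon [:: symvar p p; symvar q r]) = f@_(mon [:: symvar p q; symvar p r]).
Proof.
move=> u Pf.
have := functional_kill (T := weight411) (c := (0, 0)) u isT isT Pf.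
rewrite !big_cons big_nil /= addr0 mul1r mulN1r mon2C => /eqP.
by rewrite subr_eq0 mon2C [X in _ == _@_X]mon2C => /eqP.
Qed.

Lemma coef_path_self p q r f : uniq [:: p; q; r] -> P2 (f * Y q r) ->
  f@_(mon [:: symvar p p; symvar q r]) = f@_(mon [:: symvar p q; symvar p r]).
Proof.
move=> u Pf.
(* Exactly two monomials of [weight222] contain y_qr, with opposite signs. *)
have := functional_kill (T := weight222) (c := (1, 2)) u isT isT Pf.
rewrite !big_cons big_nil /= !mulr0 !addr0 !add0r mul1r mulN1r => /eqP.
by rewrite addrC subr_eq0 mon2C eq_sym => /eqP ->; rewrite mon2C.
Qed.

(** * Quadrics killed by all variables outside one pair of indices *)

(** With diagonal variables as loops and the others as edges, the cases are the possible shapes of a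
    two-edge multigraph, that is, of a quadratic monomial. *)
Lemma symvar_pair_ind
    (Q : 'I_#|{: sym_index n}| -> 'I_#|{: sym_index n}| -> Prop) :
  (forall u v, Q u v -> Q v u) ->
  (forall p, Q (symvar p p) (symvar p p)) ->
  (forall p q, p != q -> Q (symvar p p) (symvar p q)) ->
  (forall p q, p != q -> Q (symvar p p) (symvar q q)) ->
  (forall p q, p != q -> Q (symvar p q) (symvar p q)) ->
  (forall p q r, uniq [:: p; q; r] -> Q (symvar p p) (symvar q r)) ->
  (forall p q r, uniq [:: p; q; r] -> Q (symvar p q) (symvar p r)) ->
  (forall p q r s, uniq [:: p; q; r; s] -> Q (symvar p q) (symvar r s)) ->
  forall u v, Q u v.
Proof.
move=> symQ Q1 Q2 Q3 Q4 Q5 Q6 Q7 u v.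
have [i [j ->]] := symvarP u; have [k [l ->]] := symvarP v.
have loop a c d : Q (symvar a a) (symvar c d).
  have [->|cd] := eqVneq c d; first by have [->|/Q3] := eqVneq a d.
  have [->|ac] := eqVneq a c; first exact: Q2.
  have [->|ad] := eqVneq a d.
    by rewrite (symvarC c); apply: Q2; rewrite eq_sym.
  by apply: Q5; rewrite /= !inE negb_or ac ad cd.
have [->|ij] := eqVneq i j; first exact: loop.
have [->|kl] := eqVneq k l; first exact/symQ/loop.
have share a b d : a != b -> a != d -> Q (symvar a b) (symvar a d).
  move=> ab ad; have [->|bd] := eqVneq b d; first exact: Q4.
  by apply: Q6; rewrite /= !inE negb_or ab ad bd.
have ji : j != i by rewrite eq_sym.
have lk : l != k by rewrite eq_sym.
have [ik|ik] := eqVneq i k; first by rewrite -ik; apply: share; rewrite // ik.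
have [il|il] := eqVneq i l.
  by rewrite (symvarC k) -il; apply: share; rewrite // il.
rewrite (symvarC i).
have [jk|jk] := eqVneq j k; first by rewrite -jk; apply: share; rewrite // jk.
have [jl|jl] := eqVneq j l.
  by rewrite (symvarC k) -jl; apply: share; rewrite // jl.
by apply: Q7; rewrite /= !inE !negb_or ji jk jl ik il kl.
Qed.

Lemma two_loops_ne p q : p != q ->
  ~~ perm_eq [:: symvar p p; symvar q q] [:: symvar p q; symvar p q].
Proof.
move=> pq; apply/negP => /perm_mem/(_ (symvar p p)).
by rewrite !inE !symvar_eq !eqxx (negPf pq).
Qed.

Lemma path_ne p q r : uniq [:: p; q; r] ->
  ~~ perm_eq [:: symvar p p; symvar q r] [:: symvar p q; symvar p r].
Proof.
rewrite /= !inE negb_or => /and3P[/andP[pq pr] _ _].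
apply/negP => /perm_mem/(_ (symvar p p)).
by rewrite !inE !symvar_eq !eqxx (negPf pq) (negPf pr).
Qed.

Lemma P2_two_loops p q : p != q -> P2 (Y p p * Y q q + Y p q * Y p q).
Proof. by move=> pq; have := P2_swap K pq pq; rewrite (symvarC q p). Qed.

Lemma P2_path p q r : uniq [:: p; q; r] -> P2 (Y p p * Y q r + Y p q * Y p r).
Proof.
rewrite /= !inE negb_or => /and3P[/andP[pq pr] _ _].
by have := P2_swap K pq pr; rewrite (symvarC q p) [Y p r * _]mulrC.
Qed.

(** Induction on the support: subtracting a multiple of some g in [P2] removes a monomial and adds
    none. The coefficients of y_pp^2 and y_pp y_pq vanish; y_pp y_qq pairs with y_pq^2, and y_pp
    y_qr with y_pq y_pr, in binomials of [P2]; y_pq y_rs lies in [P2] itself. *)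
Lemma P2_quadric_of_killed f i j :
  f \is 2.-homog -> i != j ->
  (forall k l, ~~ ((k \in [:: i; j]) && (l \in [:: i; j])) -> P2 (f * Y k l)) ->
  P2 f.
Proof.
move=> hom_f ij.
move: {2}(size (msupp f)).+1 (ltnSn (size (msupp f))) => d.
elim: d f hom_f => // d IHd f hom_f lt_d kill_f.
have [->|f_neq0] := eqVneq f 0; first by case: idP2.
suff [m [g [mf Pg hom_g gm sub_g]]] : exists m g,
    [/\ m \in msupp f, P2 g, g \is 2.-homog, g@_m = 1
      & {subset msupp g <= msupp f}].
  pose f' := f - f@_m *: g.
  have Pcg : P2 (f@_m *: g) by rewrite -mul_mpolyC; apply: (ideal_mull idP2).
  have sub_f' : {subset msupp f' <= rem m (msupp f)}.
    move=> e ef'; rewrite (mem_rem_uniq _ (msupp_uniq f)) inE.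
    apply/andP; split.
      apply: contraTneq ef' => ->.
      by rewrite mcoeff_msupp mcoeffB mcoeffZ gm mulr1 subrr eqxx.
    have /msuppB_le := ef'; rewrite mem_cat => /orP[//|].
    by move/msuppZ_le/sub_g.
  have -> : f = f' + f@_m *: g by rewrite subrK.
  apply: (ideal_add idP2) => //; apply: IHd => [||k l kl].
  - by rewrite rpredB // rpredZ.
  - apply: leq_ltn_trans (uniq_leq_size (msupp_uniq f') sub_f') _.
    by rewrite size_rem //; case: ((msupp f)) lt_d mf.
  - rewrite mulrBl; apply: (ideal_sub idP2); first exact: kill_f.
    exact: (ideal_mulr idP2).
have [e ef] : exists e, e \in msupp f.
  move: f_neq0; rewrite -msupp_eq0; case: (msupp f) => // e s _.
  by exists e; rewrite mem_head.
have [s] := mdeg_mnm_of_seqP (dhomog_mf hom_f ef).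
case: s => [|u [|v []]] // _ e_uv; move: ef; rewrite {e}e_uv.
(* Equality of the two coefficients keeps the support of the binomial inside that of [f]. *)
have binomial u1 v1 u2 v2 : ~~ perm_eq [:: u1; v1] [:: u2; v2] ->
    P2 ('X_u1 * 'X_v1 + 'X_u2 * 'X_v2) ->
    f@_(mon [:: u1; v1]) = f@_(mon [:: u2; v2]) ->
    mon [:: u1; v1] \in msupp f -> exists m g,
    [/\ m \in msupp f, P2 g, g \is 2.-homog, g@_m = 1
      & {subset msupp g <= msupp f}].
  move=> ne P12 eq12 f1; exists (mon [:: u1; v1]).
  exists ('X_[mon [:: u1; v1]] + 'X_[mon [:: u2; v2]]); split=> //.
  - by rewrite !mnm_of_seq_cons !mpolyXD /mnm_of_seq big_nil mpolyX0 !mulr1.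
  - by rewrite rpredD // dhomogX /= mdeg_mnm_of_seq.
  - by rewrite mcoeffD !mcoeffX eqxx mnm_of_seq_eq perm_sym (negPf ne) addr0.
  - move=> m /msuppD_le; rewrite mem_cat !msuppX !inE => /orP[] /eqP-> //.
    by rewrite mcoeff_msupp -eq12 -mcoeff_msupp.
have mon2X u1 v1 : 'X_[mon [:: u1; v1]] = 'X_u1 * 'X_v1 :> sym_poly K n.
  by rewrite !mnm_of_seq_cons !mpolyXD /mnm_of_seq big_nil mpolyX0 !mulr1.
have third p q : p != q -> exists r, uniq [:: p; q; r].
  move=> pq; have [r /andP[rp rq]] := exists_third p q n_ge3.
  by exists r; rewrite /= !inE negb_or pq ![_ == r]eq_sym rp rq.
(* Two distinct indices inside {i, j} exhaust it, so variables through a third index kill [f]. *)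
have outside p q r : uniq [:: p; q; r] ->
    (p \in [:: i; j]) && (q \in [:: i; j]) -> r \notin [:: i; j].
  move=> pqr /andP[p_in q_in]; move: p_in q_in pqr; rewrite /= !inE !negb_or.
  rewrite ![r == _]eq_sym => /orP[]/eqP-> /orP[]/eqP->; rewrite ?eqxx //= andbT.
    by case/andP=> /andP[_ ->].
  by case/andP=> /andP[_ ->] ->.
have two_loops_eq p q : p != q ->
    f@_(mon [:: symvar p p; symvar q q]) = f@_(mon [:: symvar p q; symvar p q]).
  move=> pq.
  have [pq_in|pq_out] := boolP ((p \in [:: i; j]) && (q \in [:: i; j])).
    have [r pqr] := third _ _ pq; apply: (coef_two_loops pqr).
    by apply: kill_f; rewrite (negPf (outside _ _ _ pqr pq_in)).
  exact/(coef_two_loops_self pq)/kill_f.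
have path_eq p q r : uniq [:: p; q; r] ->
    f@_(mon [:: symvar p p; symvar q r]) = f@_(mon [:: symvar p q; symvar p r]).
  move=> pqr.
  have [qr_in|qr_out] := boolP ((q \in [:: i; j]) && (r \in [:: i; j])).
    have qrp : uniq [:: q; r; p] by rewrite -(rot_uniq 2).
    apply: (coef_path pqr); apply: kill_f.
    by rewrite (negPf (outside _ _ _ qrp qr_in)).
  exact/(coef_path_self pqr)/kill_f.
move: u v; apply: symvar_pair_ind.
- by move=> u v; rewrite mon2C.
- move=> p; rewrite mcoeff_msupp => /eqP[].
  have [pij|pij] := boolP (p \in [:: i; j]); last first.
    by apply: coef_loops_self; apply: kill_f; rewrite (negPf pij).
  have [r /andP[ri rj]] := exists_third i j n_ge3.
  have rij : r \notin [:: i; j] by rewrite !inE negb_or ri.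
  apply: (coef_loops (r := r)); last by apply: kill_f; rewrite (negPf rij).
  by apply: contraNneq rij => <-.
- move=> p q pq; rewrite mcoeff_msupp => /eqP[].
  have [pq_in|pq_out] := boolP ((p \in [:: i; j]) && (q \in [:: i; j])).
    have [r pqr] := third _ _ pq; apply: (coef_loop_edge pqr).
    by apply: kill_f; rewrite (negPf (outside _ _ _ pqr pq_in)) andbF.
  exact/(coef_loop_edge_self pq)/kill_f.
- move=> p q pq.
  apply: (binomial _ _ _ _ (two_loops_ne pq) _ (two_loops_eq _ _ pq)).
  exact: P2_two_loops.
- move=> p q pq; apply: (binomial _ _ _ _ _ _ (esym (two_loops_eq _ _ pq))).
    by rewrite perm_sym two_loops_ne.
  by rewrite addrC; apply: P2_two_loops.
- move=> p q r pqr.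
  apply: (binomial _ _ _ _ (path_ne pqr) _ (path_eq _ _ _ pqr)).
  exact: P2_path.
- move=> p q r pqr; apply: (binomial _ _ _ _ _ _ (esym (path_eq _ _ _ pqr))).
    by rewrite perm_sym path_ne.
  by rewrite addrC; apply: P2_path.
- move=> p q r s pqrs fm.
  exists (mon [:: symvar p q; symvar r s]), (Y p q * Y r s).
  rewrite -mon2X mcoeffX eqxx dhomogX /= mdeg_mnm_of_seq mon2X; split=> //.
    exact: P2_disjoint.
  by move=> m; rewrite -mon2X msuppX inE => /eqP->.
Qed.

(** * Lower bound: no form of degree below 3 works *)

(** The quadric f y is still killed by y, so the quadric relations apply to it: for y = y_ii its
    y_ii^2 coefficient vanishes; for i != j its y_ij^2 coefficient equals that of y_ii y_jj, which
    is 0 as y_ij does not divide y_ii y_jj. *)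
Lemma linear_of_killed f :
  f \is 1.-homog -> (forall k l, P2 (f * Y k l)) -> f = 0.
Proof.
move=> hom_f kill_f; apply/eqP; rewrite -msupp_eq0.
case msf: (msupp f) => [//|e s].
have ef : e \in msupp f by rewrite msf mem_head.
have [[|v []] // _ e_v] := mdeg_mnm_of_seqP (dhomog_mf hom_f ef).
move: ef; rewrite mcoeff_msupp {}e_v; have [i [j ->]] := symvarP v.
have [<-|ij] := eqVneq i j.
  have /coef_loops_self : P2 (f * Y i i * Y i i) by apply: (ideal_mulr idP2).
  by rewrite mcoeffMXU mem_head /= eqxx => ->; rewrite eqxx.
have : P2 (f * Y i j * Y i j) by apply: (ideal_mulr idP2).
move/(coef_two_loops_self ij); rewrite !mcoeffMXU mem_head /= eqxx => <-.
by rewrite !inE !symvar_eq ![j == i]eq_sym (negPf ij) !andbF /= eqxx.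
Qed.

(** Induction on the distance [d] to degree 2, where the quadric lemma puts [f] in [P2], so that 1
    would lie in [I]. *)
Lemma colon_prime_degree d e f (I : sym_poly K n -> Prop) :
  (e + d = 2)%N -> f \is e.-homog -> prime_ideal I ->
  same_set (colon P2 f) I -> False.
Proof.
elim: d e f => [|d IHd] e f ed hom_f prI colI.
all: have Pf_false : ~ P2 f
  by case: prI => _ nI1 _ Pf; apply/nI1/colI; rewrite /colon mul1r.
all: have [idI _ mulI] := prI.
  rewrite addn0 in ed; rewrite ed in hom_f.
  have [|i [j [ij out]]] := prime_P2_support prI.
    by move=> g Pg; apply/colI/(ideal_mulr idP2).
  apply/Pf_false/(P2_quadric_of_killed hom_f ij) => k l /out/colI.
  by rewrite /colon mulrC.
(* For a variable y outside the prime [I], ([P2] : f y) = ([I] : y) = [I], so the degree can be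
   raised. *)
case: (classic (exists k l, ~ I (Y k l))) => [[k [l nIkl]]|all_in].
  apply: (IHd e.+1 (f * Y k l)) prI _; first by rewrite addSnnS.
    by rewrite -addn1; apply: dhomogM => //; rewrite dhomogX /= mdeg1.
  move=> g; split=> [|Ig]; last first.
    by have /colI := Ig; rewrite /colon mulrA; apply: (ideal_mulr idP2).
  by rewrite /colon mulrCA mulrC => /colI/mulI[].
have kill_f k l : P2 (f * Y k l).
  rewrite mulrC; apply/colI; apply: NNPP => nI; apply: all_in.
  by exists k, l.
apply: Pf_false; suff -> : f = 0 by case: idP2.
(* A constant is first multiplied by a variable to reach degree one. *)
case: e ed hom_f => [|[|e]] ed hom_f; last by lia.
  have i := Ordinal n_ge3.
  have : f * Y i i = 0.
    apply: linear_of_killed => [|k l].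
      by apply: (dhomogM (d := 0) (e := 1)) => //; rewrite dhomogX /= mdeg1.
    by rewrite mulrAC; apply: (ideal_mulr idP2).
  move/eqP; rewrite mulf_eq0 => /orP[/eqP//|].
  by rewrite -msupp_eq0 msuppX.
exact: linear_of_killed.
Qed.

(** * Upper bound: the colon ideal of a triangle *)

Definition triangle a b c : sym_poly K n := Y b c * Y a c * Y a b.

Lemma triangle_rot a b c : triangle a b c = triangle b c a.
Proof. by rewrite /triangle (symvarC c a) (symvarC b a); ring. Qed.

Section Triangle.
Variables a b c : 'I_n.
Hypothesis abc : uniq [:: a; b; c].

(** For l = a, y_aa y_bc may be replaced by -y_ab y_ac, leaving a multiple of y_ac y_ab^2; for l = b
    or c such an adjacent monomial appears directly; otherwise y_bc y_al is a disjoint product. *)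
Lemma P2_triangle_in l : P2 (triangle a b c * Y a l).
Proof.
rewrite /triangle.
have := abc; rewrite /= !inE negb_or => /and3P[/andP[ab ac] bc _].
have [->|la] := eqVneq l a.
  have bac : uniq [:: b; a; c] by rewrite /= !inE negb_or eq_sym ab bc ac.
  have := ideal_sub idP2 (ideal_mull idP2 (Y a c * Y a b) (P2_path abc))
    (ideal_mull idP2 (Y a c) (P2_adjacent bac)).
  by rewrite (symvarC b a); congr P2; ring.
have [->|lb] := eqVneq l b.
  rewrite [X in P2 X](_ : _ = Y a c * (Y b c * Y a b * Y a b)); last by ring.
  exact/(ideal_mull idP2)/P2_adjacent.
have [->|lc] := eqVneq l c.
  have acb : uniq [:: a; c; b] by rewrite /= !inE negb_or ab ac eq_sym bc.
  rewrite [X in P2 X](_ : _ = Y a b * (Y b c * Y a c * Y a c)); last by ring.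
  by apply: (ideal_mull idP2); rewrite (symvarC b); apply: P2_adjacent.
rewrite [X in P2 X](_ : _ = Y a c * Y a b * (Y b c * Y a l)); last by ring.
apply/(ideal_mull idP2)/P2_disjoint.
by rewrite /= !inE !negb_or ![_ == a]eq_sym ![_ == l]eq_sym ab ac bc lb lc la.
Qed.

(** For l = k, y_kk y_bc is replaced by -y_kb y_kc, and y_kb y_ac is a disjoint product; otherwise
    y_bc y_kl is one. *)
Lemma P2_triangle_out k l : uniq [:: k; a; b; c] -> l \notin [:: a; b; c] ->
  P2 (triangle a b c * Y k l).
Proof.
rewrite /triangle.
rewrite /= !inE !negb_or => /and4P[/and3P[ka kb kc] /andP[ab ac] bc _].
case/and3P=> la lb lc; have [->|lk] := eqVneq l k.
  have kbc : uniq [:: k; b; c] by rewrite /= !inE negb_or kb kc bc.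
  have kb_ac : P2 (Y k b * Y a c).
    apply: P2_disjoint.
    by rewrite /= !inE !negb_or kb ka kc (eq_sym b) ab bc ac.
  have := ideal_sub idP2 (ideal_mull idP2 (Y a c * Y a b) (P2_path kbc))
    (ideal_mull idP2 (Y k c * Y a b) kb_ac).
  by congr P2; ring.
rewrite [X in P2 X](_ : _ = Y a c * Y a b * (Y b c * Y k l)); last by ring.
apply/(ideal_mull idP2)/P2_disjoint.
by rewrite /= !inE !negb_or ![_ == k]eq_sym ![_ == l]eq_sym bc
  ![_ == k]eq_sym kb kc lb lc eq_sym lk.
Qed.

End Triangle.

Variables p q r : 'I_n.
Hypothesis pqr : uniq [:: p; q; r].

Lemma triangle_mul k l : P2 (triangle p q r * Y k l).
Proof.
have mul_in k1 l1 : k1 \in [:: p; q; r] -> P2 (triangle p q r * Y k1 l1).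
  rewrite !inE => /or3P[]/eqP->; first exact: P2_triangle_in.
    by rewrite triangle_rot; apply: P2_triangle_in; rewrite -(rot_uniq 2).
  by rewrite 2!triangle_rot; apply: P2_triangle_in; rewrite -(rot_uniq 1).
have [/mul_in//|k_out] := boolP (k \in [:: p; q; r]).
have [/mul_in|l_out] := boolP (l \in [:: p; q; r]).
  by rewrite symvarC.
by apply: P2_triangle_out; rewrite // cons_uniq k_out.
Qed.

Lemma triangle_notin : ~ P2 (triangle p q r).
Proof.
move=> Pt; have := pqr; rewrite /= !inE negb_or => /and3P[/andP[pq pr] qr _].
have T_ok := allP weights_ok weight222 (mem_head _ _).
have := functional_P2 pq pr qr T_ok Pt.
(* This is the last monomial of [weight222], where the functional takes the value 1. *)
have -> : triangle p q r =
    'X_[mon (map (class_var p q r) [:: (1, 2); (0, 2); (0, 1)])].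
  by rewrite !mnm_of_seq_cons !mpolyXD /mnm_of_seq big_nil mpolyX0 mulr1 mulrA.
rewrite functionalX // -map_comp map_id_in; last first.
  by move=> x; rewrite !inE => /or3P[]/eqP->; apply: class_varK.
by move/eqP; rewrite (_ : weight_at _ _ = 1) // oner_eq0.
Qed.

(** The colon ideal is thus the maximal graded ideal: every nonconstant monomial contains a
    variable, which kills the triangle modulo [P2]. *)
Lemma colon_triangle g : colon P2 (triangle p q r) g <-> g@_0%MM = 0.
Proof.
have colon0 h : h@_0%MM = 0 -> P2 (h * triangle p q r).
  move=> h0; rewrite (mpolyE h) mulr_suml; apply: (ideal_sum idP2) => m _.
  rewrite -scalerAl -mul_mpolyC.
  have [[|v s] ->] := mnm_of_seqP m.
    rewrite [mon [::]]big_nil h0 mpolyC0 mul0r; by case: idP2.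
  apply: (ideal_mull idP2); rewrite mnm_of_seq_cons mpolyXD -mulrA mulrCA.
  apply: (ideal_mull idP2); have [k [l ->]] := symvarP v.
  by rewrite mulrC; apply: triangle_mul.
split=> [Pg|]; last exact: colon0.
apply/eqP; apply: contraPT triangle_notin => g0 nPt; apply: nPt.
(* Removing the nonconstant part of [g] leaves a nonzero scalar times the triangle in [P2]. *)
have := ideal_sub idP2 Pg (colon0 (g - (g@_0%MM)%:MP) _).
rewrite mcoeffB mcoeffC eqxx mulr1 subrr => /(_ erefl).
rewrite -mulrBl subKr => /(ideal_mull idP2 ((g@_0%MM)^-1)%:MP).
by rewrite mulrA -mpolyCM mulVf // mul1r.
Qed.

Lemma colon_triangle_prime : prime_ideal (colon P2 (triangle p q r)).
Proof.
split=> [|/colon_triangle/eqP|x y /colon_triangle].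
- split=> [|x y Ix Iy|z x Ix]; rewrite /colon.
  + by rewrite mul0r; case: idP2.
  + by rewrite mulrDl; apply: (ideal_add idP2).
  + by rewrite -mulrA; apply: (ideal_mull idP2).
- by rewrite mcoeff1 eqxx oner_eq0.
- rewrite rmorphM /= => /eqP; rewrite mulf_eq0.
  by case/orP=> /eqP ?; [left|right]; apply/colon_triangle.
Qed.

Lemma triangle_homog : triangle p q r \is 3.-homog.
Proof.
have homY i j : Y i j \is 1.-homog by rewrite dhomogX /= mdeg1.
exact: dhomogM (dhomogM (homY _ _) (homY _ _)) (homY _ _).
Qed.

End PermanentalIdealTheory.

(** * The value of the v-number *)

Theorem theorem4p7 (K : fieldType) (n : nat)
    (char_neq2 : 2%N \notin [pchar K]%R) (n_ge3 : (3 <= n)%N) :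
  is_v_number (permanental_ideal2 (generic_symmx K n)) 3.
Proof.
have two_neq0 : 2%:R != 0 :> K by move: char_neq2; rewrite inE.
have [i [j ij]] : exists i j : 'I_n, i != j.
  have i0 := Ordinal n_ge3; have [j /andP[ji _]] := exists_third i0 i0 n_ge3.
  by exists j, i0.
have [k /andP[ki kj]] := exists_third i j n_ge3.
have ijk : uniq [:: i; j; k].
  by rewrite /= !inE negb_or ij ![_ == k]eq_sym ki kj.
split.
  exists (triangle K i j k).
  exists (colon (permanental_ideal2 (generic_symmx K n)) (triangle K i j k)).
  have prI := colon_triangle_prime two_neq0 ijk.
  split=> //; first exact: triangle_homog.
  by split=> //; exists (triangle K i j k).
move=> e [f [I [hom_f [prI _] colI]]]; rewrite leqNgt; apply/negP => e_lt3.
have e2 : (e + (2 - e) = 2)%N by lia.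
exact: (colon_prime_degree two_neq0 n_ge3 e2 hom_f prI colI).
Qed.
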